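(* Let $G$ be a separable metrizable topological group. Then there is a Polish space $X$ such that (i) $G$ acts continuously on $X$; and (ii) whenever $G$ acts continuously on a separable metrizable space $Y$, there is a map $\pi:Y\to X$ which is continuous and one-to-one and satisfies $\pi(g\cdot y)=g\cdot \pi(y)$ for all $g\in G$ and $y\in Y$.
   Context: A Polish space is a separable topological space admitting a compatible complete metric. A continuous action of $G$ on a space $Z$ means the action map $G\times Z\to Z$ is jointly continuous. *)

(* Defs.v *)
From HB Require Import structures.
From mathcomp Require Import all_boot all_order all_algebra.
From mathcomp Require Import all_classical all_reals all_analysis.
From mathcomp Require Import Rstruct Rstruct_topology.
Set Implicit Arguments. Unset Strict Implicit. Unset Printing Implicit Defensive.
Import Order.TTheory GRing.Theory Num.Theory.
Local Open Scope classical_set_scope.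
Local Open Scope ring_scope.
Local Notation R := Rdefinitions.R.

Definition is_metric (T : Type) (d : T -> T -> R) : Prop :=
  [/\ forall x y, 0 <= d x y,
      forall x y, d x y = 0 <-> x = y,
      forall x y, d x y = d y x &
      forall x y z, d x z <= d x y + d y z].

Definition compatible_metric (T : topologicalType) (d : T -> T -> R) : Prop :=
  forall A : set T, open A <->
    (forall x, A x -> exists e : R, 0 < e /\ [set y | d x y < e] `<=` A).

Definition complete_metric (T : Type) (d : T -> T -> R) : Prop :=
  forall u : nat -> T,
    (forall e : R, 0 < e -> exists N, forall m n, (N <= m)%N -> (N <= n)%N ->
        d (u m) (u n) < e) ->
    exists l, forall e : R, 0 < e -> exists N, forall n, (N <= n)%N -> d (u n) l < e.

Definition separable_space (T : topologicalType) : Prop :=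
  exists S : set T, countable S /\ dense S.

Definition metrizable (T : topologicalType) : Prop :=
  exists d : T -> T -> R, is_metric d /\ compatible_metric d.

Definition polish (T : topologicalType) : Prop :=
  separable_space T /\
  exists d : T -> T -> R, [/\ is_metric d, compatible_metric d & complete_metric d].

Definition is_topological_group (G : topologicalType)
    (mul : G -> G -> G) (inv : G -> G) (one : G) : Prop :=
  [/\ forall x y z, mul x (mul y z) = mul (mul x y) z,
      forall x, mul one x = x /\ mul x one = x,
      forall x, mul (inv x) x = one /\ mul x (inv x) = one,
      continuous (fun p : G * G => mul p.1 p.2) &
      continuous inv].

Definition continuous_action (G : topologicalType) (mul : G -> G -> G) (one : G)
    (Z : topologicalType) (act : G -> Z -> Z) : Prop :=
  [/\ forall z, act one z = z,
      forall g h z, act (mul g h) z = act g (act h z) &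
      continuous (fun p : G * Z => act p.1 p.2)].

(* Main.v *)
(**
  Idea.  Birkhoff-Kakutani gives a right-invariant metric [rdist] on [G].  A point [y] of a
  [G]-space [Y] and an open [U] in [Y] yield the 1-Lipschitz function
  [h |-> dist(h, {g | g y in U})] on [G].  The point [y] is coded by such functions for
  countably many [U], and [G] acts on codes by right translation of the argument.  The
  functions depend only upper semicontinuously on [y], so codes carry the topology
  generated by the sets [F i h < r].  To make this space regular, and hence Polish, the
  family of open sets is closed under two operations: [U] is exhausted by open sets [a_j],
  each coming with an open [b_j] such that [U] and [b_j] cover [Y] while [a_j] and [b_j]
  stay apart even after moving by a small element of [G].  These relations are
  [G]-invariant, and in terms of the Lipschitz functions they need only be tested on a
  countable dense subset of [G]: two closed sets cover [G] as soon as every basic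
  open set meets one of them.  That makes the set of codes a [Pi^0_2] set even though
  [G] is neither countable nor complete.
*)
Require Import Defs.
From HB Require Import structures.
From mathcomp Require Import all_boot all_order all_algebra.
From mathcomp Require Import all_classical all_reals all_analysis.
From mathcomp Require Import Rstruct Rstruct_topology.
From mathcomp Require Import lra.
Set Implicit Arguments. Unset Strict Implicit. Unset Printing Implicit Defensive.
Import Order.TTheory GRing.Theory Num.Theory numFieldNormedType.Exports.
Local Open Scope classical_set_scope.
Local Open Scope ring_scope.

(** * Finite intersections in filters and openness through neighborhoods *)

(** At most [n] indices have [pickle] below [n], so finite intersections suffice. *)
Lemma near_pickle (I : countType) (T : Type) (F : set_system T) (FF : Filter F)
    (P : I -> T -> Prop) (n : nat) :
  (forall i, F (P i)) -> F [set x | forall i, (pickle i < n)%N -> P i x].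
Proof.
move=> HP; elim: n => [|n IH]; first exact: filterE.
case e : (@pickle_inv I n) => [i|].
  apply: filterS2 IH (HP i) => x Hx Px j.
  rewrite ltnS leq_eqVlt => /orP[/eqP jn|/Hx //].
  by move: (@pickleK_inv I j); rewrite jn e => -[<-].
apply: filterS IH => x Hx j; rewrite ltnS leq_eqVlt => /orP[/eqP jn|/Hx //].
by move: (@pickleK_inv I j); rewrite jn e.
Qed.

Lemma open_nearP (T : topologicalType) (A : set T) :
  (forall x, A x -> \forall y \near x, A y) -> open A.
Proof. by move=> H; rewrite openE. Qed.

Lemma open_near (T : topologicalType) (A : set T) (x : T) :
  open A -> A x -> \forall y \near x, A y.
Proof. by move=> oA Ax; apply: open_nbhs_nbhs. Qed.

(** * Normality and Urysohn functions from a countable regular base *)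

Section regular_base.
Variables (R : realType) (T : topologicalType) (L : countType) (O : L -> set T).
Hypothesis openO : forall l, open (O l).
Hypothesis regO : forall A x, open A -> A x ->
  exists l, O l x /\ closure (O l) `<=` A.

(** Tychonoff's construction for regular Lindelof spaces: take the basic sets whose closure misses
    [B] and remove from each the closures, up to its own index, that miss [A]. *)
Let shrink (A B : set T) : set T := [set x | exists i,
  [/\ closure (O i) `&` B = set0, O i x &
      forall j, (pickle j < (pickle i).+1)%N -> closure (O j) `&` A = set0 ->
        ~ closure (O j) x]].

Let shrink_open A B : open (shrink A B).
Proof.
apply: open_nearP => x [i [iB ix Hj]].
(* Only finitely many closed sets are removed, so a whole neighborhood of [x] avoids those that [x]
   avoids. *)
have : \forall y \near x, forall j, (pickle j < (pickle i).+1)%N ->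
    closure (O j) `&` A = set0 /\ ~ closure (O j) x -> ~ closure (O j) y.
  apply: near_pickle => j; have [nx|nx] := pselect (~ closure (O j) x); last first.
    by apply: filterE => y [].
  have := open_near (closed_openC (closed_closure (A := O j))) nx.
  by apply: filterS => y.
apply: filterS2 (open_near (openO i) ix) => y iy Hy; exists i; split=> // j ji jA.
by apply: Hy => //; split=> //; exact: Hj.
Qed.

Let shrink_sub A B : closed B -> A `&` B = set0 -> A `<=` shrink A B.
Proof.
move=> cB AB x Ax.
have [|i [ix iB]] := regO (closed_openC cB) (x := x).
  by move=> Bx; have : (A `&` B) x by []; rewrite AB.
exists i; split=> //; first exact/disjoints_subset.
by move=> j _ jA jx; have : (closure (O j) `&` A) x by []; rewrite jA.
Qed.

Lemma regular_base_normal : normal_space T.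
Proof.
apply/(@normal_openP R) => A B cA cB AB.
exists (shrink A B), (shrink B A); split=> //.
- exact: shrink_sub.
- by apply: shrink_sub => //; rewrite setIC.
rewrite -subset0 => x [[i [iB ix Hi]] [j [jA jx Hj]]].
(* The basic set of smaller index is among those removed in the other construction; the non-strict
   bound on [pickle] settles equal indices. *)
have [ij|ji] := leqP (pickle i) (pickle j).
  by case: (Hj i) => //; exact: subset_closure.
by case: (Hi j) => //; [exact: ltnW|exact: subset_closure].
Qed.

Lemma regular_base_urysohn : exists u : L * L -> T -> R,
  [/\ forall p, continuous (u p),
      forall p x, 0 <= u p x <= 1,
      forall p x, u p x < 1 -> O p.2 x &
      forall p x, closure (O p.1) `<=` O p.2 -> O p.1 x -> u p x = 0].
Proof.
have H (p : L * L) : exists f : T -> R, [/\ continuous f, forall x, 0 <= f x <= 1,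
    forall x, f x < 1 -> O p.2 x &
    forall x, closure (O p.1) `<=` O p.2 -> O p.1 x -> f x = 0].
  have [sub|nsub] := pselect (closure (O p.1) `<=` O p.2); last first.
    (* Without nested closures the constant 1 satisfies the last two clauses vacuously. *)
    exists (fun=> 1); split=> // => [x|x|x]; first exact: cvg_cst.
      by rewrite ler01 lexx.
    by rewrite ltxx.
  have sep : uniform_separator (closure (O p.1)) (~` O p.2).
    apply: (normal_separatorP (R := R)).1; first exact: regular_base_normal.
    - exact: closed_closure.
    - exact/open_closedC.
    - by apply/disjoints_subset; rewrite setCK.
  move/(@uniform_separatorP _ R) : sep => [f [cf f01 f0 f1]]; exists f; split=> // x.
  - by have /f01 : range f (f x) by []; rewrite /= in_itv.
  - move=> fx; apply: contrapT => nx.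
    have /f1 /= fx1 : (f @` (~` O p.2)) (f x) by exists x.
    by move: fx; rewrite fx1 ltxx.
  - by move=> _ /subset_closure Ox; apply/f0; exists x.
have [u Hu] := choice H; exists u; split=> p; by have [] := Hu p.
Qed.

End regular_base.

(** * A truncated supremum describing pointwise convergence *)

Section wsup.
Variables (R : realType) (P : countType).
Implicit Types f g : P -> R.

(** The caps tend to 0 along [pickle], so smallness is decided by finitely many coordinates; the
    extra 0 keeps the set nonempty when [P] is empty. *)
Definition wsup f : R := sup [set t | t = 0 \/
  exists p, t = Num.min (pickle p).+1%:R^-1 `|f p| ].

Let has_sup_wsup f : has_sup [set t | t = 0 \/
  exists p, t = Num.min (pickle p).+1%:R^-1 `|f p| ].
Proof.
split; first by exists 0; left.
exists 1 => t [->|[p ->]] //.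
by rewrite ge_min invf_le1 ?ltr0n// ler1n.
Qed.

Lemma wsup_ge0 f : 0 <= wsup f.
Proof. by apply: ub_le_sup; [have [] := has_sup_wsup f|left]. Qed.

Lemma wsup_ge f p : Num.min (pickle p).+1%:R^-1 `|f p| <= wsup f.
Proof. by apply: ub_le_sup; [have [] := has_sup_wsup f|right; exists p]. Qed.

Lemma wsup_le f c : 0 <= c ->
  (forall p, Num.min (pickle p).+1%:R^-1 `|f p| <= c) -> wsup f <= c.
Proof.
move=> c0 H; apply: ge_sup; first by have [] := has_sup_wsup f.
by move=> t [->|[p ->]].
Qed.

Lemma wsup_le_fin f n c : n.+1%:R^-1 <= c ->
  (forall p, (pickle p < n)%N -> `|f p| <= c) -> wsup f <= c.
Proof.
move=> nc H; apply: wsup_le => [|p]; first exact: le_trans nc.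
have [pn|np] := ltnP (pickle p) n; first by rewrite ge_min H ?orbT.
rewrite ge_min (le_trans _ nc)// lef_pV2 ?posrE ?ltr0n//.
by rewrite ler_nat ltnS.
Qed.

(** Capping preserves subadditivity: for nonnegative entries [Num.min a (s + t) <= Num.min a s +
    Num.min a t]. *)
Lemma wsup_leD f g : wsup f <= wsup g + wsup (fun p => f p - g p).
Proof.
apply: wsup_le => [|p]; first by rewrite addr_ge0 ?wsup_ge0.
apply: le_trans (lerD (wsup_ge g p) (wsup_ge (fun p => f p - g p) p)).
have := ler_normD (g p) (f p - g p); rewrite addrC subrK.
have : 0 < (pickle p).+1%:R^-1 :> R by rewrite invr_gt0 ltr0n.
have := normr_ge0 (g p); have := normr_ge0 (f p - g p).
move: (_^-1) `|g p| `|f p - g p| `|f p| => a b c e *.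
by rewrite /Num.min; case: ifP; case: ifP; case: ifP; lra.
Qed.

Lemma wsup_eq0 f : wsup f = 0 -> forall p, f p = 0.
Proof.
move=> f0 p; have := wsup_ge f p; rewrite f0 ge_min => /orP[|].
  by rewrite leNgt invr_gt0 ltr0n.
by rewrite normr_le0 => /eqP.
Qed.

Lemma wsup_lt f p e : 0 < e ->
  wsup f < Num.min (pickle p).+1%:R^-1 e -> `|f p| < e.
Proof.
move=> e0; rewrite lt_min => /andP[h1 h2]; have := wsup_ge f p.
by rewrite ge_min => /orP[/le_lt_trans/(_ h1)|/le_lt_trans/(_ h2)//]; rewrite ltxx.
Qed.

Lemma near_wsup (T : Type) (F : set_system T) (FF : Filter F) (f : T -> P -> R) :
  (forall p e, 0 < e -> \forall x \near F, `|f x p| < e) ->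
  forall e, 0 < e -> \forall x \near F, wsup (f x) < e.
Proof.
move=> H e e0; have e2 : 0 < e / 2 by lra.
have [n _ /(_ _ (leqnn n)) /= nE] := near_infty_natSinv_lt (PosNum e2).
have := near_pickle FF n (fun p => H p _ e2).
apply: filterS => x Hx; apply: (@le_lt_trans _ _ (e / 2)); last by lra.
by apply: wsup_le_fin (ltW nE) _ => p /Hx /ltW.
Qed.

Lemma wsup_continuous (T : topologicalType) (f : T -> P -> R) :
  (forall p, continuous (fun x => f x p)) -> continuous (fun x => wsup (f x)).
Proof.
move=> cf x; apply/cvgrPdist_lt => e e0.
have H (g : T -> P -> R) : (forall p e, 0 < e -> \forall y \near x, `|g y p| < e) ->
  \forall y \near x, wsup (g y) < e by move=> ?; exact: near_wsup.
near=> y.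
have h1 : wsup (fun p => f x p - f y p) < e.
  by near: y; apply: H => p e' e'0; have /cvgrPdist_lt/(_ _ e'0) := cf p x.
have h2 : wsup (fun p => f y p - f x p) < e.
  by near: y; apply: H => p e' e'0; have /cvgrPdistC_lt/(_ _ e'0) := cf p x.
have := wsup_leD (f x) (f y); have := wsup_leD (f y) (f x).
rewrite ltr_norml; lra.
Unshelve. all: by end_near.
Qed.

End wsup.

(** * The metric induced by countably many real coordinates *)

(** The metric clause of [polish] over any [realType]; for [Rdefinitions.R] the two agree by
    conversion. *)
Definition complete_metrization (R : realType) (X : topologicalType) (d : X -> X -> R) :=
  [/\ [/\ forall x y, 0 <= d x y, forall x y, d x y = 0 <-> x = y,
          forall x y, d x y = d y x & forall x y z, d x z <= d x y + d y z],
      forall A : set X, open A <->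
        (forall x, A x -> exists e : R, 0 < e /\ [set y | d x y < e] `<=` A) &
      forall u : nat -> X,
        (forall e : R, 0 < e -> exists N, forall m n, (N <= m)%N -> (N <= n)%N ->
            d (u m) (u n) < e) ->
        exists l, forall e : R, 0 < e -> exists N, forall n, (N <= n)%N ->
            d (u n) l < e].

Section coordinate_metric.
Variables (R : realType) (X : topologicalType) (P : countType) (w : P -> X -> R).
Hypothesis cw : forall p, continuous (w p).
Hypothesis base_w : forall A x, open A -> A x ->
  exists p (e : R), 0 < e /\ forall y, `|w p x - w p y| < e -> A y.
Hypothesis sep_w : forall x y, (forall p, w p x = w p y) -> x = y.
Hypothesis complete_w : forall u : nat -> X,
  (forall p, exists l, w p (u n) @[n --> \oo] --> (l : R)) -> exists y : X, u @ \oo --> y.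

(** Pulled back from a countable power of the line: [base_w] makes the coordinate map an embedding,
    and [complete_w] makes its image closed. *)
Definition coord_dist x y : R := wsup (fun p => w p x - w p y).

Lemma coord_dist_ge0 x y : 0 <= coord_dist x y.
Proof. exact: wsup_ge0. Qed.

Lemma coord_dist_sym x y : coord_dist x y = coord_dist y x.
Proof.
suff H a b : coord_dist a b <= coord_dist b a by apply/eqP; rewrite eq_le !H.
by apply: wsup_le => [|p]; [exact: wsup_ge0|rewrite distrC; exact: wsup_ge].
Qed.

Lemma coord_dist_eq0 x y : coord_dist x y = 0 <-> x = y.
Proof.
split=> [d0|->]; last first.
  apply/eqP; rewrite eq_le coord_dist_ge0 andbT; apply: wsup_le => // p.
  by rewrite subrr normr0 ge_min lexx orbT.
by apply: sep_w => p; apply/eqP; rewrite -subr_eq0 (wsup_eq0 d0 p).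
Qed.

Lemma coord_dist_triangle x y z : coord_dist x z <= coord_dist x y + coord_dist y z.
Proof.
apply: le_trans (wsup_leD _ (fun p => w p x - w p y)) _.
rewrite lerD2l; apply: wsup_le => [|p]; first exact: wsup_ge0.
by rewrite opprB addrC addrA subrK; exact: wsup_ge.
Qed.

Lemma near_coord_dist x e : 0 < e -> \forall y \near x, coord_dist x y < e.
Proof.
move=> e0; apply: near_wsup e0 => p e' e'0.
by have /cvgrPdist_lt/(_ _ e'0) := cw (p := p) (x := x).
Qed.

Lemma coord_dist_lt p e x y : 0 < e ->
  coord_dist x y < Num.min (pickle p).+1%:R^-1 e -> `|w p x - w p y| < e.
Proof. exact: wsup_lt. Qed.

Lemma coord_dist_open (A : set X) : open A <->
  forall x, A x -> exists e : R, 0 < e /\ [set y | coord_dist x y < e] `<=` A.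
Proof.
split=> [oA x Ax|H].
  have [p [e [e0 He]]] := base_w oA Ax.
  exists (Num.min (pickle p).+1%:R^-1 e); split.
    by rewrite lt_min e0 invr_gt0 ltr0n.
  by move=> y /(coord_dist_lt e0) /He.
apply: open_nearP => x /H [e [e0 eA]].
by apply: filterS (near_coord_dist x e0) => y; exact: eA.
Qed.

Lemma coord_dist_complete (u : nat -> X) :
  (forall e : R, 0 < e -> exists N, forall m n, (N <= m)%N -> (N <= n)%N ->
     coord_dist (u m) (u n) < e) ->
  exists l, forall e : R, 0 < e -> exists N, forall n, (N <= n)%N ->
     coord_dist (u n) l < e.
Proof.
move=> Hu; have [p|l ul] := complete_w (u := u).
  suff /cvg_ex[l Hl] : cvgn (fun n => w p (u n)) by exists l.
  apply/cauchy_cvgP/cauchy_exP => e e0.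
  have [|N HN] := Hu (Num.min (pickle p).+1%:R^-1 e).
    by rewrite lt_min e0 invr_gt0 ltr0n.
  exists (w p (u N)); exists N => // n /= Nn.
  by apply: (coord_dist_lt e0); exact: HN.
exists l => e e0; have [N _ HN] := ul _ (near_coord_dist l e0).
by exists N => n Nn; rewrite coord_dist_sym; exact: HN.
Qed.

End coordinate_metric.

(** * Complete metrizability of spaces cut out by countably many implications *)

(* A countable regular base embeds [X] in the power set of [L]; [condO] and [compO] say
   that the image is the [Pi^0_2] set cut out by the implications
   "[O (t c)] holds -> [O l] holds for some [l] in [Q c]", where [t c = None] stands for
   an empty premise. *)
Section pi02_criterion.
Variables (R : realType) (X : topologicalType) (L C : countType) (O : L -> set X).
Variables (t : C -> option L) (Q : C -> set L).
Hypothesis openO : forall l, open (O l).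
Hypothesis regO : forall A x, open A -> A x ->
  exists l, O l x /\ closure (O l) `<=` A.
Hypothesis sepO : forall x y, (forall l, O l x <-> O l y) -> x = y.
Hypothesis condO : forall c x, (if t c is Some l then O l x else True) ->
  exists l, Q c l /\ O l x.
Hypothesis compO : forall (u : nat -> X) (S : set L),
  (forall l, S l -> \forall n \near \oo, O l (u n)) ->
  (forall c, (if t c is Some l then S l else True) -> exists l, Q c l /\ S l) ->
  exists y : X, u @ \oo --> y.

Lemma separable_of_base : separable_space X.
Proof.
have [[x0 _]|nX] := pselect (exists x : X, True); last first.
  by exists set0; split=> // A [x]; case: nX; exists x.
have /choice[f Hf] : forall l, exists x, O l !=set0 -> O l x.
  by move=> l; have [[x lx]|n] := pselect (O l !=set0); [exists x|exists x0].
exists (range f); split; first exact: card_le_trans (card_image_le f setT) (countableP _).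
move=> A [x Ax] oA; have [l [lx lA]] := regO oA Ax.
exists (f l); split; last by exists l.
by apply/lA/subset_closure/Hf; exists x.
Qed.

Section with_urysohn.
Variable u : L * L -> X -> R.
Hypothesis cu : forall p, continuous (u p).
Hypothesis u01 : forall p x, 0 <= u p x <= 1.
Hypothesis u_lt1 : forall p x, u p x < 1 -> O p.2 x.
Hypothesis u_eq0 : forall p x, closure (O p.1) `<=` O p.2 -> O p.1 x -> u p x = 0.

(* [denom c l m] is positive by [condO]. If its inverse converges
   along a sequence where [guard] tends to a value below [1 - m.+1^-1], then [weight]
   does not tend to 0, so some [u p] with [Q c p.2] has a limit less than 1. *)
Let weight c x : R := wsup (fun p => if `[< Q c p.2 >] then 1 - u p x else 0).
Let guard c l x : R := if t c is Some l' then u (l, l') x else 0.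
Let denom c l m x : R := weight c x + Num.max 0 (guard c l x - (1 - m.+1%:R^-1)).
(** Adding inverses of positive continuous functions as coordinates is the classical remetrization
    of a countable intersection of open sets. *)
Let w (p : (L * L) + (C * L * nat)) : X -> R := match p with
  | inl p => u p
  | inr (c, l, m) => fun x => (denom c l m x)^-1
  end.

Let guard_cond c l x : guard c l x < 1 -> if t c is Some l' then O l' x else True.
Proof. by rewrite /guard; case: (t c) => // l' /u_lt1. Qed.

(** Regularity is applied twice, since a Urysohn pair needs the closure of its first set inside its
    second, and the second inside [A]. *)
Let base_u A x : open A -> A x -> exists p, u p x = 0 /\ O p.2 `<=` A.
Proof.
move=> oA Ax; have [l' [l'x l'A]] := regO oA Ax.
have [l [lx ll']] := regO (openO l') l'x.
exists (l, l'); split; first exact: u_eq0.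
by apply: subset_trans l'A; exact: subset_closure.
Qed.

Let denom_gt0 c l m x : 0 < denom c l m x.
Proof.
have m0 : 0 < m.+1%:R^-1 :> R by rewrite invr_gt0 ltr0n.
(* If [guard] is at least 1 the second summand is positive; otherwise the premise of [c] holds and
   [condO] makes [weight] positive. *)
have [g1|g1] := leP 1 (guard c l x).
  apply: ltr_wpDl; first exact: wsup_ge0.
  rewrite lt_max; apply/orP; right.
  by move: m0 g1; move: (guard _ _ _) (_^-1) => g e; lra.
apply: ltr_pwDl; last by rewrite le_max lexx.
have [l' [Ql' l'x]] := condO (guard_cond g1).
have [l1 [l1x l1l']] := regO (openO l') l'x.
have := wsup_ge (fun p => if `[< Q c p.2 >] then 1 - u p x else 0) (l1, l').
rewrite /= (asboolT Ql') (u_eq0 (p := (l1, l')) l1l' l1x) subr0 normr1.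
by apply: lt_le_trans; rewrite lt_min ltr01 invr_gt0 ltr0n.
Qed.

Let weight_continuous c : continuous (weight c).
Proof.
apply: wsup_continuous => p x; case: asboolP => _; last exact: cvg_cst.
by apply: cvgB; [exact: cvg_cst|exact: cu].
Qed.

Let denom_continuous c l m : continuous (denom c l m).
Proof.
move=> x; apply: cvgD; first exact: weight_continuous.
apply: (@continuous_max _ _ (fun=> 0)
  (fun x => guard c l x - (1 - m.+1%:R^-1)) x); first exact: cvg_cst.
apply: cvgB; last exact: cvg_cst.
by rewrite /guard; case: (t c) => [l'|]; [exact: cu|exact: cvg_cst].
Qed.

Let w_continuous p : continuous (w p).
Proof.
case: p => [p|[[c l] m]]; first exact: cu.
move=> x; apply: (cvgV (f := denom c l m)); last exact: denom_continuous.
by rewrite gt_eqF.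
Qed.

Let w_complete (v : nat -> X) :
  (forall p, exists l, w p (v n) @[n --> \oo] --> (l : R)) ->
  exists y : X, v @ \oo --> y.
Proof.
(* A basic set enters [S] when one of its Urysohn functions has a limit below 1, which puts the
   sequence eventually inside it. *)
move=> Hv; pose S := [set l' | exists l (a : R),
  u (l, l') (v n) @[n --> \oo] --> a /\ a < 1].
apply: (compO (S := S)) => [l' [l [a [ua a1]]]|c Hc].
  by apply: filterS (cvgr_lt a ua _ a1) => n; exact: u_lt1.
have [l [a [ga a1]]] : exists l (a : R), guard c l (v n) @[n --> \oo] --> a /\ a < 1.
  move: Hc; rewrite /guard; case: (t c) => [l'|_] //.
  (* With no premise [guard] is 0; regularity of the whole space only supplies some index [l]. *)
  have [l _] := regO (@openT X) (I : setT (v 0%N)).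
  by exists l, 0; split=> //; exact: cvg_cst.
apply: contrapT => nS.
have a1' : 0 < 1 - a by lra.
(* For this [m] the second summand of [denom] is eventually 0, while [nS] forces [weight] to tend to
   0; then the inverse cannot converge. *)
have [m _ /(_ _ (leqnn m)) /= mE] := near_infty_natSinv_lt (PosNum a1').
have [M HM] := Hv (inr (c, l, m)).
have M1 : 0 < `|M| + 1 by rewrite ltr_wpDl.
have wn : \forall n \near \oo, weight c (v n) < (`|M| + 1)^-1.
  apply: near_wsup; last by rewrite invr_gt0.
  move=> p e e0; case: asboolP => [Qp|_]; last by apply: filterE; rewrite normr0.
  have [b ub] := Hv (inl p).
  have b1 : 1 - e < b.
    suff : 1 <= b by lra.
    by rewrite leNgt; apply/negP => b1; apply: nS; exists p.2; split=> //;
      exists p.1, b; split=> //; rewrite -surjective_pairing.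
  apply: filterS (cvgr_gt b ub _ b1) => n /= un.
  have /andP[_ un1] := u01 p (v n).
  by rewrite ger0_norm ?subr_ge0// ltrBlDr -ltrBlDl.
have gn : \forall n \near \oo, guard c l (v n) < 1 - m.+1%:R^-1.
  by apply: (cvgr_lt a ga); rewrite ltrBrDl -ltrBrDr.
have Mn : \forall n \near \oo, w (inr (c, l, m)) (v n) < `|M| + 1.
  by apply: (cvgr_lt M HM); have := ler_norm M; lra.
have [n [[wn' gn'] /=]] := filter_ex (filterI (filterI wn gn) Mn).
rewrite -[X in _ < X]invrK ltf_pV2 ?posrE ?invr_gt0 ?denom_gt0// /denom max_l.
  by rewrite addr0 => h; have := lt_trans wn' h; rewrite ltxx.
by rewrite subr_le0 ltW.
Qed.

Lemma complete_metrization_of_urysohn : exists d : X -> X -> R, complete_metrization d.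
Proof.
exists (coord_dist w); split; last 1 first.
- exact: coord_dist_complete w_continuous w_complete.
- split; [exact: coord_dist_ge0| |exact: coord_dist_sym|exact: coord_dist_triangle].
  apply: coord_dist_eq0 => x y wxy; apply: sepO => l.
  suff H a b : (forall p, w p a = w p b) -> O l a -> O l b.
    by split; apply: H => // p; rewrite wxy.
  move=> wab la; have [p [pa pl]] := base_u (openO l) la.
  by apply/pl/u_lt1; have /= <- := wab (inl p); rewrite pa.
- apply: coord_dist_open; first exact: w_continuous.
  move=> A x oA Ax; have [p [px pA]] := base_u oA Ax.
  exists (inl p), 1; split=> // y; rewrite /= px sub0r normrN => uy.
  by apply/pA/u_lt1; apply: le_lt_trans uy; exact: ler_norm.
Qed.

End with_urysohn.

Lemma pi02_complete_metrization : exists d : X -> X -> R, complete_metrization d.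
Proof.
have [u [cu u01 u_lt1 u_eq0]] := regular_base_urysohn R openO regO.
exact: complete_metrization_of_urysohn cu u01 u_lt1 u_eq0.
Qed.

End pi02_criterion.

Lemma polish_of_pi02 (X : topologicalType) (L C : countType) (O : L -> set X)
    (t : C -> option L) (Q : C -> set L) :
  (forall l, open (O l)) ->
  (forall A x, open A -> A x -> exists l, O l x /\ closure (O l) `<=` A) ->
  (forall x y, (forall l, O l x <-> O l y) -> x = y) ->
  (forall c x, (if t c is Some l then O l x else True) -> exists l, Q c l /\ O l x) ->
  (forall (u : nat -> X) (S : set L),
    (forall l, S l -> \forall n \near \oo, O l (u n)) ->
    (forall c, (if t c is Some l then S l else True) -> exists l, Q c l /\ S l) ->
    exists y : X, u @ \oo --> y) ->
  polish X.
Proof.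
move=> oO rO sO cO compO; split; first exact: separable_of_base rO.
exact: (@pi02_complete_metrization Rdefinitions.R _ _ _ _ _ _ oO rO sO cO compO).
Qed.

(** * The Birkhoff-Kakutani construction of a norm on a metrizable group *)

Lemma continuous_nbhs2 (U V W : topologicalType) (f : U * V -> W) (x : U) (y : V)
    (A : set W) : continuous f -> nbhs (f (x, y)) A ->
  exists B C, [/\ nbhs x B, nbhs y C & forall b c, B b -> C c -> A (f (b, c))].
Proof.
move=> cf /cf [[B C] /= [xB yC] BC]; exists B, C; split=> // b c Bb Cc.
exact: (BC (b, c)).
Qed.

Section group_norm.
Variables (R : realType) (G : topologicalType).
Variables (mul : G -> G -> G) (inv : G -> G) (one : G).
Hypothesis hG : is_topological_group mul inv one.

Let mulA x y z : mul x (mul y z) = mul (mul x y) z. Proof. by case: hG. Qed.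
Let mul1 x : mul one x = x. Proof. by case: hG => _ /(_ x)[]. Qed.
Let mulx1 x : mul x one = x. Proof. by case: hG => _ /(_ x)[]. Qed.
Let mulVx x : mul (inv x) x = one. Proof. by case: hG => _ _ /(_ x)[]. Qed.
Let mulxV x : mul x (inv x) = one. Proof. by case: hG => _ _ /(_ x)[]. Qed.
Let cmul : continuous (fun p : G * G => mul p.1 p.2). Proof. by case: hG. Qed.
Let cinv : continuous inv. Proof. by case: hG. Qed.

Lemma group_invM x y : inv (mul x y) = mul (inv y) (inv x).
Proof.
rewrite -[RHS]mulx1 -(mulxV (mul x y)) mulA -[LHS]mul1.
by congr (mul _ _); rewrite -mulA (mulA (inv x)) mulVx mul1 mulVx.
Qed.

Lemma group_inv1 : inv one = one.
Proof. by rewrite -[LHS]mulx1 mulVx. Qed.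

Lemma group_invK x : inv (inv x) = x.
Proof. by rewrite -[LHS]mulx1 -(mulVx x) mulA mulVx mul1. Qed.

Section chains.
Variable N : nat -> set G.
Hypothesis N0 : N 0%N = setT.
Hypothesis N1 : forall k, N k one.
Hypothesis N3 : forall k x y z, N k.+1 x -> N k.+1 y -> N k.+1 z ->
  N k (mul x (mul y z)).

Let half : R := 2^-1.
(** A pair [(k, g)] stands for a factor [g] taken from [N k] at cost [half ^+ k]; the norm will be
    the infimum of the costs of all such factorizations. *)
Let cost (s : seq (nat * G)) : R := foldr (fun p c => half ^+ p.1 + c) 0 s.
Let prd (s : seq (nat * G)) : G := foldr (fun p g => mul p.2 g) one s.
Let chain (s : seq (nat * G)) : Prop := foldr (fun p P => N p.1 p.2 /\ P) True s.

Let half_gt0 k : 0 < half ^+ k. Proof. by rewrite exprn_gt0// invr_gt0 ltr0n. Qed.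

Let N_le j k : (j <= k)%N -> N k `<=` N j.
Proof.
move=> /subnK <-; elim: (k - j)%N => //= n IH x; rewrite addSn => Nx.
by apply: IH; rewrite -[x]mulx1 -[one]mulx1; apply: N3.
Qed.

Let half_lt j k : half ^+ j < half ^+ k -> (k < j)%N.
Proof.
rewrite ltnNge; apply: contraTN => jk; rewrite -leNgt.
by apply: ler_wiXn2l => //; rewrite /half; lra.
Qed.

Let cost_ge0 s : 0 <= cost s.
Proof. by elim: s => //= p s; apply: addr_ge0; exact/ltW. Qed.

Let cost_cat s1 s2 : cost (s1 ++ s2) = cost s1 + cost s2.
Proof. by elim: s1 => [|p s1 IH] /=; rewrite ?add0r// IH addrA. Qed.

Let prd_cat s1 s2 : prd (s1 ++ s2) = mul (prd s1) (prd s2).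
Proof. by elim: s1 => [|p s1 IH] /=; rewrite ?mul1// IH mulA. Qed.

Let chain_cat s1 s2 : chain (s1 ++ s2) <-> chain s1 /\ chain s2.
Proof. by elim: s1 => [|p s1 IH] /=; [split=> [|[]]|rewrite IH; split=> [[? []]|[[]]]]. Qed.

(** The factor [p] is the first at which the running cost reaches [c]. *)
Let cost_split s c : 0 <= c -> c < cost s -> exists s1 p s2,
  [/\ s = s1 ++ p :: s2, cost s1 <= c & cost s2 <= cost s - c].
Proof.
elim: s c => [|p s IH] c c0 /=; first by rewrite ltNge c0.
move=> cs; have [cp|pc] := leP c (half ^+ p.1).
  by exists [::], p, s; split=> //=; move: cp; move: (half ^+ _) => e *; lra.
have [||s1 [q [s2 [-> h1 h2]]]] := IH (c - half ^+ p.1).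
- by rewrite subr_ge0 ltW.
- by rewrite ltrBlDl.
exists (p :: s1), q, s2; split=> //=.
  by rewrite -lerBrDl.
by move: h2; rewrite cost_cat /=; lra.
Qed.

(* A chain is cut at the factor where half of its cost is reached; both remaining
   pieces then cost less than [half ^+ k.+1], and so does the middle factor by itself,
   because the costs of single factors are powers of [half]. *)
Let chain_in n s k : (size s <= n)%N -> chain s -> cost s < half ^+ k -> N k (prd s).
Proof.
elim: n s k => [|n IH] s k; first by rewrite leqn0 size_eq0 => /eqP ->.
move=> sn cs sk; case: s => [//|q s0] in sn cs sk *.
move E : (q :: s0) sn cs sk => s sn cs sk.
have s0' : 0 < cost s by rewrite -E /= ltr_pwDl.
have [||s1 [p [s2 [sE h1 h2]]]] := cost_split (s := s) (c := cost s / 2).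
- by rewrite divr_ge0 ?cost_ge0.
- by lra.
move: sn cs sk h1 h2; rewrite sE size_cat /= addnS ltnS cost_cat prd_cat /=.
move=> sn /chain_cat[c1 /= [Np c2]] sk h1 h2.
have e1 := cost_ge0 s1; have e2 := cost_ge0 s2; have ep := half_gt0 p.1.
have kk : half ^+ k = 2 * half ^+ k.+1 by rewrite exprS mulrA mulfV ?mul1r.
apply: N3.
- by apply: IH c1 _; [exact: leq_trans (leq_addr _ _) sn|lra].
- apply: (N_le (k := p.1)) => //; apply: half_lt; lra.
- by apply: IH c2 _; [exact: leq_trans (leq_addl _ _) sn|lra].
Qed.

Let costs g : set R := [set c | exists s, [/\ chain s, prd s = g & c = cost s]].
Let norm g : R := inf (costs g).

Let has_inf_costs g : has_inf (costs g).
Proof.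
split; last by exists 0 => c [s [_ _ ->]]; exact: cost_ge0.
(* [N 0%N] is the whole group, so [g] alone is a chain of cost 1. *)
by exists (cost [:: (0%N, g)]), [:: (0%N, g)]; split; rewrite /= ?mulx1 ?N0.
Qed.

Let norm_le s : chain s -> norm (prd s) <= cost s.
Proof.
by move=> cs; apply: ge_inf; [have [] := has_inf_costs (prd s)|exists s].
Qed.

Let norm_ge0 g : 0 <= norm g.
Proof.
apply: lb_le_inf; first by have [] := has_inf_costs g.
by move=> c [s [_ _ ->]]; exact: cost_ge0.
Qed.

Let normP g e : norm g < e -> exists s, [/\ chain s, prd s = g & cost s < e].
Proof.
move=> ge; have [c [s [cs sg ->]] ce] := inf_lt (has_inf_costs g).1 ge.
by exists s.
Qed.

Let norm_le_half k g : N k g -> norm g <= half ^+ k.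
Proof.
move=> Ng; have := norm_le (s := [:: (k, g)]); rewrite /= mulx1 addr0.
exact.
Qed.

Let norm_in k g : norm g < half ^+ k -> N k g.
Proof. by move=> /normP[s [cs <- sk]]; exact: chain_in (leqnn _) cs sk. Qed.

Let norm1 : norm one = 0.
Proof.
by apply/eqP; rewrite eq_le norm_ge0 andbT; exact: (norm_le (s := [::])).
Qed.

Let normM g h : norm (mul g h) <= norm g + norm h.
Proof.
apply/ler_addgt0Pr => e e0.
have [|s [cs sg se]] := @normP g (norm g + e / 2); first by lra.
have [|s' [cs' sh se']] := @normP h (norm h + e / 2); first by lra.
have : chain (s ++ s') by apply/chain_cat.
by move=> /norm_le; rewrite prd_cat cost_cat sg sh; lra.
Qed.

Lemma chain_norm : exists norm : G -> R,
  [/\ forall g, 0 <= norm g, norm one = 0,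
      forall g h, norm (mul g h) <= norm g + norm h,
      forall k g, N k g -> norm g <= 2^-1 ^+ k &
      forall k g, norm g < 2^-1 ^+ k -> N k g].
Proof. by exists norm. Qed.

End chains.

Lemma cube_nbhs (V : set G) : nbhs one V ->
  exists W, nbhs one W /\ forall x y z, W x -> W y -> W z -> V (mul x (mul y z)).
Proof.
have square (A : set G) : nbhs one A ->
    exists B, nbhs one B /\ forall x y, B x -> B y -> A (mul x y).
  move=> A1; have [|B [C [B1 C1 BC]]] := continuous_nbhs2 (x := one) (y := one) (A := A) cmul.
    by rewrite /= mul1.
  exists (B `&` C); split; first exact: filterI.
  by move=> x y [Bx _] [_ Cy]; exact: BC.
move=> /square[A [A1 AV]]; have [B [B1 BA]] := square _ A1.
exists (A `&` B); split; first exact: filterI.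
by move=> x y z [Ax _] [_ By] [_ Bz]; apply: AV => //; exact: BA.
Qed.

Hypothesis hmet : metrizable G.

(** The metric provides a countable base of balls at [one]; each new set is cubed into its
    predecessor and shrunk into the next ball. *)
Lemma cube_nbhs_sequence : exists N : nat -> set G,
  [/\ N 0%N = setT, forall k, nbhs one (N k),
      forall k x y z, N k.+1 x -> N k.+1 y -> N k.+1 z -> N k (mul x (mul y z)) &
      forall V, nbhs one V -> exists k, N k `<=` V].
Proof.
have [d [[d_ge0 d_eq0 _ d_tri] d_open]] := hmet.
have ball_nbhs k : nbhs one [set g | d one g < k.+1%:R^-1].
  apply: open_nbhs_nbhs; split; last first.
    by rewrite /= (d_eq0 _ _).2// invr_gt0 ltr0n.
  apply/d_open => g /= gk; exists (k.+1%:R^-1 - d one g); rewrite subr_gt0; split=> //.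
  move=> h /=; rewrite ltrBrDl; exact: le_lt_trans.
have /choice[f Hf] : forall p : nat * set G, exists W, nbhs one p.2 ->
    [/\ nbhs one W, W `<=` [set g | d one g < p.1.+1%:R^-1] &
        forall x y z, W x -> W y -> W z -> p.2 (mul x (mul y z))].
  move=> [k V] /=; have [V1|nV] := pselect (nbhs one V); last by exists set0.
  have [W [W1 W3]] := cube_nbhs V1.
  exists (W `&` [set g | d one g < k.+1%:R^-1]) => _; split; first exact: filterI.
    by move=> g [].
  by move=> x y z [Wx _] [Wy _] [Wz _]; exact: W3.
pose N := fix N k := if k is k'.+1 then f (k', N k') else setT.
have N1 k : nbhs one (N k) by elim: k => [|k /(Hf (k, N k))[]] //; exact: filterT.
exists N; split=> // [k x y z|V V1]; first by have [_ _] := Hf (k, N k) (N1 k); exact.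
have [e [e0 eV]] := (d_open V°).1 (@open_interior _ V) one V1.
have [k _ /(_ _ (leqnn k)) /= ke] := near_infty_natSinv_lt (PosNum e0).
exists k.+1 => g Ng; apply: interior_subset; apply: eV.
by have [_ /(_ g Ng) /= gk _] := Hf (k, N k) (N1 k); exact: lt_trans ke.
Qed.

(** The norm of chains is symmetrized by a maximum with its value at the inverse; continuity of
    [inv] keeps its balls neighborhoods of [one]. *)
Lemma group_norm_exists : exists norm : G -> R,
  [/\ forall g, 0 <= norm g, norm one = 0,
      forall g h, norm (mul g h) <= norm g + norm h,
      forall g, norm (inv g) = norm g &
      (forall e, 0 < e -> nbhs one [set g | norm g < e]) /\
      (forall V, nbhs one V -> exists e : R, 0 < e /\ [set g | norm g < e] `<=` V)].
Proof.
have [N [N0 N1 N3 NV]] := cube_nbhs_sequence.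
have [nu [nu_ge0 nu1 nuM nuN Nnu]] :=
  chain_norm N0 (fun k => nbhs_singleton (N1 k)) N3.
have nu_nbhs e : 0 < e -> nbhs one [set g | nu g < e].
  move=> e0; have [k _ /(_ _ (leqnn k)) /=] := near_infty_natSinv_expn_lt (PosNum e0).
  rewrite div1r -exprVn => ke.
  by apply: filterS (N1 k) => g /nuN /le_lt_trans; exact.
exists (fun g => Num.max (nu g) (nu (inv g))); split.
- by move=> g; rewrite le_max nu_ge0.
- by rewrite group_inv1 nu1 maxxx.
- move=> g h; rewrite group_invM.
  have := nuM g h; have := nuM (inv h) (inv g).
  move: (nu (mul _ _)) (nu (mul g h)) (nu g) (nu h) (nu (inv g)) (nu (inv h)).
  by move=> a b c e c' e'; rewrite /Num.max; case: ifP; case: ifP; case: ifP; lra.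
- by move=> g; rewrite group_invK maxC.
split=> [e e0|V /NV[k kV]].
  have : nbhs one (inv @^-1` [set g | nu g < e]).
    by apply: cinv; rewrite /= group_inv1; exact: nu_nbhs.
  by apply: filterS2 (nu_nbhs e e0) => g h1 h2; rewrite /= gt_max; apply/andP.
exists (2^-1 ^+ k); split; first by rewrite exprn_gt0// invr_gt0 ltr0n.
by move=> g /=; rewrite gt_max => /andP[/Nnu + _]; exact: kV.
Qed.

End group_norm.

(** * The space of codes, its topology and the action on it *)

Section codes.
Variables (R : realType) (G : topologicalType).
Variables (mul : G -> G -> G) (inv : G -> G) (one : G).
Hypothesis hG : is_topological_group mul inv one.
Variable norm : G -> R.
Hypothesis norm_ge0 : forall g, 0 <= norm g.
Hypothesis norm1 : norm one = 0.
Hypothesis normM : forall g h, norm (mul g h) <= norm g + norm h.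
Hypothesis normV : forall g, norm (inv g) = norm g.
Hypothesis norm_nbhs : forall e, 0 < e -> nbhs one [set g | norm g < e].

Let mulA x y z : mul x (mul y z) = mul (mul x y) z. Proof. by case: hG. Qed.
Let mulx1 x : mul x one = x. Proof. by case: hG => _ /(_ x)[]. Qed.
Let mulVx x : mul (inv x) x = one. Proof. by case: hG => _ _ /(_ x)[]. Qed.
Let mulxV x : mul x (inv x) = one. Proof. by case: hG => _ _ /(_ x)[]. Qed.
Let cmul : continuous (fun p : G * G => mul p.1 p.2). Proof. by case: hG. Qed.

(** Right invariance keeps right translates of 1-Lipschitz functions 1-Lipschitz, which is what lets
    [G] act on codes. *)
Definition rdist g h := norm (mul g (inv h)).

Lemma rdist_ge0 g h : 0 <= rdist g h. Proof. exact: norm_ge0. Qed.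

Lemma rdistxx g : rdist g g = 0. Proof. by rewrite /rdist mulxV. Qed.

Lemma rdistC g h : rdist g h = rdist h g.
Proof. by rewrite /rdist -normV (group_invM hG) (group_invK hG). Qed.

Lemma rdist_triangle g h k : rdist g k <= rdist g h + rdist h k.
Proof.
apply: le_trans (normM _ _).
by rewrite mulA -(mulA g) mulVx mulx1.
Qed.

Lemma rdistMr g h k : rdist (mul g k) (mul h k) = rdist g h.
Proof. by rewrite /rdist (group_invM hG) mulA -(mulA g) mulxV mulx1. Qed.

Lemma near_rdist h e : 0 < e -> \forall g \near h, rdist g h < e.
Proof.
move=> e0; have [|B [C [hB hC BC]]] := continuous_nbhs2 (x := h) (y := inv h)
  (A := [set g | norm g < e]) cmul.
  by rewrite /= mulxV; exact: norm_nbhs.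
by apply: filterS hB => g /BC; apply; exact: nbhs_singleton hC.
Qed.

Lemma near_rdistM h g e : 0 < e -> \forall g' \near g, rdist (mul h g') (mul h g) < e.
Proof.
move=> e0; have [|B [C [hB hC BC]]] := continuous_nbhs2 (x := h) (y := g)
  (A := [set k | rdist k (mul h g) < e]) cmul.
  exact: near_rdist.
by apply: filterS hC => g' /(BC h); apply; exact: nbhs_singleton hB.
Qed.

Variables (I : countType) (a b : I -> nat -> I).

Let eps (j : nat) : R := j.+1%:R^-1.

Let eps_gt0 j : 0 < eps j. Proof. by rewrite invr_gt0 ltr0n. Qed.

Let eps_le1 j : eps j <= 1. Proof. by rewrite invf_le1 ?ltr0n// ler1n. Qed.

(* [F i h] stands for the distance from [h] to the set of [g] moving the coded point into
   the [i]-th open set, truncated at 1. *)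
Definition is_code (F : I -> G -> R) : Prop :=
  [/\ forall i h, 0 <= F i h <= 1,
      forall i h h', F i h <= F i h' + rdist h h',
      forall i j h, F i h = 0 \/ F (b i j) h = 0,
      forall i j h, F (a i j) h < j.+1%:R^-1 -> j.+1%:R^-1 <= F (b i j) h &
      forall i h r, 0 < r -> r <= 1 -> F i h < r ->
        exists j h', rdist h h' < r /\ F (a i j) h' < j.+1%:R^-1].

Definition code := {F : I -> G -> R | is_code F}.

Implicit Types (x y : code) (i : I) (h : G).

Lemma code_eq x y : (forall i h, sval x i h = sval y i h) -> x = y.
Proof.
case: x y => [F cF] [F' cF'] /= H.
have FF' : F = F' by apply/funext => i; apply/funext => h.
by rewrite FF' in cF *; congr exist; exact: Prop_irrelevance.
Qed.

Let code_ge0 x i h : 0 <= sval x i h.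
Proof. by have [/(_ i h)/andP[]] := svalP x. Qed.

Let code_le1 x i h : sval x i h <= 1.
Proof. by have [/(_ i h)/andP[]] := svalP x. Qed.

Let code_lip x i h h' : sval x i h <= sval x i h' + rdist h h'.
Proof. by have [] := svalP x. Qed.

Let code_cover x i j h : sval x i h = 0 \/ sval x (b i j) h = 0.
Proof. by have [] := svalP x. Qed.

Let code_apart x i j h : sval x (a i j) h < eps j -> eps j <= sval x (b i j) h.
Proof. by have [_ _ _ H _] := svalP x; exact: H. Qed.

Let code_refine x i h r : r <= 1 -> sval x i h < r ->
  exists j h', rdist h h' < r /\ sval x (a i j) h' < eps j.
Proof.
move=> r1 xr; have r0 : 0 < r := le_lt_trans (code_ge0 _ _ _) xr.
by have [_ _ _ _ H] := svalP x; exact: H.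
Qed.

(** Where [a i j] is small, [b i j] is not 0, so covering forces the value at [i] to be 0. *)
Let code_apart0 x i j h : sval x (a i j) h < eps j -> sval x i h = 0.
Proof.
move=> /code_apart bh; have [//|b0] := code_cover x i j h.
by move: bh; rewrite b0 leNgt eps_gt0.
Qed.

(** Only strict upper bounds occur, because a code depends upper semicontinuously on the coded
    point. *)
Definition code_box (s : seq (I * G * R)) : set code :=
  [set x | foldr (fun p P => sval x p.1.1 p.1.2 < p.2 /\ P) True s].

Lemma code_box_cat s t x : code_box (s ++ t) x <-> code_box s x /\ code_box t x.
Proof.
by elim: s => [|p s IH] /=; [split=> [|[]]|split=> [[? /IH[]]|[[? ?] ?]]; split=> //; exact/IH].
Qed.

Definition code_open : set_system code :=
  [set A | forall x, A x -> exists s, code_box s x /\ code_box s `<=` A].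

Let code_openT : code_open setT.
Proof. by move=> x _; exists [::]. Qed.

Let code_openI : setI_closed code_open.
Proof.
move=> A B oA oB x [/oA[s [sx sA]] /oB[t [tx tB]]]; exists (s ++ t).
by split=> [|y /code_box_cat[/sA ? /tB]]; first exact/code_box_cat.
Qed.

Let code_open_bigU (J : Type) (f : J -> set code) :
  (forall j, code_open (f j)) -> code_open (\bigcup_j f j).
Proof.
move=> of_ x [j _ /of_[s [sx sf]]]; exists s; split=> // y /sf fy.
by exists j.
Qed.

HB.instance Definition _ := gen_eqMixin code.
HB.instance Definition _ := gen_choiceMixin code.
HB.instance Definition _ :=
  isOpenTopological.Build code code_openT code_openI code_open_bigU.

Lemma code_box_open s : open (code_box s : set code).
Proof. by move=> x sx; exists s; split. Qed.

Lemma code_cvg (T : Type) (F : set_system T) (FF : Filter F) (f : T -> code) x :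
  (forall i h r, sval x i h < r -> \forall u \near F, sval (f u) i h < r) -> f @ F --> x.
Proof.
move=> H A; rewrite nbhsE => -[B [oB Bx] BA].
have [s [sx sB]] := oB _ Bx.
suff sF : F (f @^-1` code_box s).
  by apply: (filterS (P := f @^-1` code_box s)) => // u /sB/BA.
elim: s sx {sB} => [|p s IH] /=; first by move=> _; exact: filterE.
by move=> [/H px /IH sx]; apply: filterS2 px sx.
Qed.

Lemma near_code x i h r : sval x i h < r -> \forall y \near x, sval y i h < r.
Proof.
move=> xr; have xs : code_box [:: (i, h, r)] x by split.
by apply: filterS (open_near (@code_box_open _) xs) => y [].
Qed.

Lemma is_code_act g x : is_code (fun i h => sval x i (mul h g)).
Proof.
split=> [i h|i h h'|i j h|i j h|i h r r0 r1 /(code_refine r1)[j [h' [hh' ah']]]].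
- by rewrite code_ge0 code_le1.
- by rewrite -(rdistMr h h' g); exact: code_lip.
- exact: code_cover.
- exact: code_apart.
exists j, (mul h' (inv g)); rewrite -mulA mulVx mulx1; split=> //.
by rewrite -(rdistMr _ _ g) -mulA mulVx mulx1.
Qed.

Definition code_act g x : code := exist _ _ (is_code_act g x).

Lemma code_act_continuous : continuous_action mul one code_act.
Proof.
split=> [x|g g' x|[g x]].
- by apply: code_eq => i h /=; rewrite mulx1.
- by apply: code_eq => i h /=; rewrite mulA.
apply: code_cvg => i h r /= xr.
(* Half of the slack absorbs the change of code, the other half the motion of [g] through the
   Lipschitz bound. *)
pose e := (r - sval x i (mul h g)) / 2.
have e0 : 0 < e by rewrite divr_gt0 ?subr_gt0.
have re : sval x i (mul h g) < r - e by rewrite /e; lra.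
exists ([set g' | rdist (mul h g') (mul h g) < e],
        [set y | sval y i (mul h g) < r - e]).
  by split; [exact: near_rdistM|exact: near_code].
move=> [g' y] [/= g'e ye]; apply: le_lt_trans (code_lip _ _ _ (mul h g)) _; lra.
Qed.

(** * A countable regular base and Polishness of the space of codes *)

Variable e : nat -> G.
Hypothesis dense_e : forall h r, 0 < r -> exists n, rdist (e n) h < r.

Let atom (p : I * nat * nat) : I * G * R := (p.1.1, e p.1.2, eps p.2).
Let O (l : seq (I * nat * nat)) : set code := code_box (map atom l).

Let dense_eps h (r : R) : 0 < r -> exists n k, rdist (e n) h < eps k /\ eps k < r.
Proof.
move=> r0; have [k _ /(_ _ (leqnn k)) /= kr] := near_infty_natSinv_lt (PosNum r0).
by have [n nk] := dense_e h (eps_gt0 k); exists n, k.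
Qed.

Let O1 p x : O [:: p] x <-> sval x p.1.1 (e p.1.2) < eps p.2.
Proof. by split=> [[]|]. Qed.

Let regular_sub x i h r : sval x i h < r ->
  exists l, O l x /\ closure (O l) `<=` [set y | sval y i h < r].
Proof.
have [r1 _|r1 xr] := ltP 1 r.
  by exists [::]; split=> // y _; exact: le_lt_trans (code_le1 _ _ _) r1.
have [j [h' [hh' ah']]] := code_refine r1 xr.
(* The dense point [e n] is close enough to [h'] to keep [a i j] below [eps j] there and to stay
   within [r] of [h]. *)
have [|n [k [nk kr]]] := dense_eps h' (r := Num.min (r - rdist h h') (eps j - sval x (a i j) h')).
  by rewrite lt_min !subr_gt0 hh'.
move: kr; rewrite lt_min => /andP[k1 k2].
exists [:: (a i j, n, j)]; split.
  apply/O1; apply: le_lt_trans (code_lip _ _ _ h') _ => /=.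
  by move: nk k2; move: (eps k) => ?; lra.
(* On the box [b i j] is at least [eps j] at [e n] by [code_apart]; this condition is closed, so it
   survives in the closure, where covering then makes the value at [i] vanish. *)
move=> y yO /=; have by_ : eps j <= sval y (b i j) (e n).
  rewrite leNgt; apply/negP => /near_code /yO[z [/O1 /= /code_apart]].
  by rewrite leNgt => /negP.
have y0 : sval y i (e n) = 0.
  have [//|b0] := code_cover y i j (e n).
  by move: by_; rewrite b0 leNgt eps_gt0.
apply: le_lt_trans (code_lip y i h (e n)) _; rewrite y0 add0r.
apply: le_lt_trans (rdist_triangle _ h' _) _; rewrite (rdistC h').
by move: nk k1; move: (eps k) => ?; lra.
Qed.

Let O_regular A x : open A -> A x -> exists l, O l x /\ closure (O l) `<=` A.
Proof.
move=> oA Ax; have [s [sx sA]] := oA _ Ax.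
suff [l [lx ls]] : exists l, O l x /\ closure (O l) `<=` code_box s.
  by exists l; split=> //; exact: subset_trans sA.
elim: s sx {sA} => [_|p s IH /= [px /IH[l [lx ls]]]]; first by exists [::].
have [l' [l'x l'p]] := regular_sub px.
exists (l' ++ l); rewrite /O map_cat; split; first exact/code_box_cat.
by move=> y yc; split; [apply: l'p|apply: ls]; apply: closureS yc => z /code_box_cat[].
Qed.

Let O_sep x y : (forall l, O l x <-> O l y) -> x = y.
Proof.
move=> xy; apply: code_eq => i h.
suff H x' y' : (forall l, O l y' -> O l x') -> sval x' i h <= sval y' i h.
  by apply/eqP; rewrite eq_le !H// => l; case: (xy l).
move=> yx; rewrite leNgt; apply/negP => /regular_sub[l [/yx lx /(_ x')]].
by rewrite /= ltxx; apply/not_implyP; split=> //; exact: subset_closure.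
Qed.

(** Conditions [inl] express covering, tested on balls around dense points, and [inr] express
    refinement. The other clauses of [is_code] need no condition: they follow from the form of the
    limit or pass to it. *)
Let cond_dom (c : (I * nat * nat * nat) + (I * nat * nat)) :
    option (seq (I * nat * nat)) :=
  if c is inr p then Some [:: p] else None.

Let cond_cod (c : (I * nat * nat * nat) + (I * nat * nat)) :
    set (seq (I * nat * nat)) :=
  match c with
  | inl (i, j, n, k) => [set l | exists i' n' k', [/\ l = [:: (i', n', k')],
      i' = i \/ i' = b i j & eps k' + rdist (e n') (e n) < eps k]]
  | inr (i, n, k) => [set l | exists j h n' k', [/\ l = [:: (a i j, n', k')],
      rdist (e n) h < eps k & eps k' + rdist (e n') h < eps j]]
  end.

Let O_cond c x : (if cond_dom c is Some l then O l x else True) ->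
  exists l, cond_cod c l /\ O l x.
Proof.
case: c => [[[[i j] n] k] _|[[i n] k] /O1 /= xn].
  have kk : eps k.+1 < eps k by rewrite ltf_pV2 ?posrE ?ltr0n// ltr_nat.
  have [i0|b0] := code_cover x i j (e n).
    exists [:: (i, n, k.+1)]; split; last by apply/O1; rewrite i0.
    by exists i, n, k.+1; split; [|left|rewrite rdistxx addr0].
  exists [:: (b i j, n, k.+1)]; split; last by apply/O1; rewrite b0.
  by exists (b i j), n, k.+1; split; [|right|rewrite rdistxx addr0].
have [j [h [nh ah]]] := code_refine (eps_le1 k) xn.
(* A second refinement reaches a point [h'] where the value at [a i j] is 0, so that boxes with
   arbitrarily small bounds are available near it. *)
have [j' [h' [hh' ah']]] := code_refine (eps_le1 j) ah.
have [|n' [k' [n'h' k'j]]] := dense_eps h' (r := (eps j - rdist h h') / 2).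
  by rewrite divr_gt0 ?subr_gt0.
exists [:: (a i j, n', k')]; split.
  exists j, h, n', k'; split=> //.
  have := rdist_triangle (e n') h' h; rewrite (rdistC h' h).
  by move: n'h' k'j; move: (eps k') (eps j) => ? ?; lra.
by apply/O1; apply: le_lt_trans (code_lip _ _ _ h') _; rewrite (code_apart0 ah') add0r.
Qed.

(* [S] collects the boxes that the limit must belong to. *)
Section limit.
Variables (u : nat -> code) (S : set (seq (I * nat * nat))).
Hypothesis S_near : forall l, S l -> \forall n \near \oo, O l (u n).
Hypothesis S_cond : forall c, (if cond_dom c is Some l then S l else True) ->
  exists l, cond_cod c l /\ S l.

(** The infimum is the largest 1-Lipschitz function bounded by 1 that obeys every bound [eps k] at
    [e n] recorded by the singleton boxes in [S]. *)
Let vals i h : set R := [set c | c = 1 \/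
  exists n k, S [:: (i, n, k)] /\ c = eps k + rdist (e n) h].
Let F i h : R := inf (vals i h).

Let has_inf_vals i h : has_inf (vals i h).
Proof.
split; first by exists 1; left.
by exists 0 => c [->|[n [k [_ ->]]]]//; rewrite addr_ge0 ?rdist_ge0 ?ltW.
Qed.

Let F_ge0 i h : 0 <= F i h.
Proof.
apply: lb_le_inf; first by have [] := has_inf_vals i h.
by move=> c [->|[n [k [_ ->]]]]//; rewrite addr_ge0 ?rdist_ge0 ?ltW.
Qed.

Let F_le1 i h : F i h <= 1.
Proof. by apply: ge_inf; [have [] := has_inf_vals i h|left]. Qed.

Let F_le i n k h : S [:: (i, n, k)] -> F i h <= eps k + rdist (e n) h.
Proof.
by move=> Sp; apply: ge_inf; [have [] := has_inf_vals i h|right; exists n, k].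
Qed.

Let F_lt i h r : r <= 1 -> F i h < r ->
  exists n k, S [:: (i, n, k)] /\ eps k + rdist (e n) h < r.
Proof.
move=> r1 /(inf_lt (has_inf_vals i h).1)[c [->|[n [k [Sp ->]]]] cr].
  by move: cr; rewrite ltNge r1.
by exists n, k.
Qed.

Let F_near i h r : F i h < r -> \forall n \near \oo, sval (u n) i h < r.
Proof.
have [r1 _|r1 /(F_lt r1)[n [k [Sp nkr]]]] := ltP 1 r.
  by apply: filterE => n; exact: le_lt_trans (code_le1 _ _ _) r1.
apply: filterS (S_near Sp) => m /O1 /= um.
apply: le_lt_trans (code_lip _ _ _ (e n)) _; rewrite rdistC.
by apply: lt_trans nkr; rewrite ltrD2r.
Qed.

Let F_code : is_code F.
Proof.
split=> [i h|i h h'|i j h|i j h ah|i h r r0 r1 /(F_lt r1)[n [k [Sp nkr]]]].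
- by rewrite F_ge0 F_le1.
- rewrite -lerBlDr; apply: lb_le_inf; first by have [] := has_inf_vals i h'.
  move=> c [->|[n [k [Sp ->]]]]; first by have := F_le1 i h; have := rdist_ge0 h h'; lra.
  have := F_le h Sp; have := rdist_triangle (e n) h' h; rewrite (rdistC h' h).
  by lra.
- apply: contrapT => /not_orP[/eqP i0 /eqP b0].
  (* If both values were positive at [h], a ball of half their minimum would yield a recorded bound
     pushing one of them below that minimum. *)
  have [|n [k [nk kr]]] := dense_eps h (r := Num.min (F i h) (F (b i j) h) / 2).
    by rewrite divr_gt0// lt_min !lt_neqAle !F_ge0 !andbT eq_sym i0 eq_sym b0.
  have [|l [[i' [n' [k' [-> i'E n'n]]]] Sp]] := S_cond (c := inl (i, j, n, k)) => //.
  have : F i' h < Num.min (F i h) (F (b i j) h).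
    have := F_le h Sp; have := rdist_triangle (e n') (e n) h.
    move: n'n nk kr; move: (eps k) (eps k') (Num.min _ _) => *; lra.
  by rewrite lt_min; case: i'E => ->; rewrite ltxx ?andbF.
(* Both strict bounds hold eventually along [u], so a violation would already occur in some
   [u m]. *)
- rewrite leNgt; apply/negP => bh.
  have [m [/= am bm]] := filter_ex (filterI (F_near ah) (F_near bh)).
  by move: bm; rewrite ltNge code_apart.
have [|l [[j [h' [n' [k' [-> nh' n'h']]]]] Sl]] := S_cond (c := inr (i, n, k)) => //.
exists j, h'; split; last exact: le_lt_trans (F_le h' Sl) n'h'.
have := rdist_triangle h (e n) h'; rewrite (rdistC h (e n)).
by move: nkr nh'; move: (eps k) => *; lra.
Qed.

Lemma code_limit : exists y : code, u @ \oo --> y.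
Proof. by exists (exist _ F F_code); apply: code_cvg; exact: F_near. Qed.

End limit.

Lemma code_polish : polish code.
Proof.
apply: (polish_of_pi02 (O := O) (t := cond_dom) (Q := cond_cod)).
- by move=> l; exact: (@code_box_open _).
- exact: O_regular.
- exact: O_sep.
- exact: O_cond.
- exact: code_limit.
Qed.

End codes.

(** * Enumerations of countable dense sets *)

(** Sets with at most one point encode a partial enumeration, which needs no default point and so
    covers empty spaces. *)
Lemma countable_index (T : Type) (A : set T) : countable A ->
  exists f : nat -> set T, (forall n x y, f n x -> f n y -> x = y) /\
    forall x, A x <-> exists n, f n x.
Proof.
move=> /countable_injP[f f_inj].
exists (fun n => [set x | A x /\ f x = n]); split=> [n x y [Ax fx] [Ay fy]|x].
  by apply: f_inj; rewrite ?inE// fx.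
by split=> [Ax|[n []]//]; exists (f x).
Qed.

Lemma dense_sequence (T : topologicalType) (x0 : T) : separable_space T ->
  exists e : nat -> T, forall A, open A -> A !=set0 -> exists n, A (e n).
Proof.
move=> [S [/countable_index[f [f_uniq fS]] dS]].
have /choice[e He] : forall n, exists x, forall y, f n y -> y = x.
  move=> n; have [[x fx]|nx] := pselect (exists x, f n x).
    by exists x => y /f_uniq; exact.
  by exists x0 => y fy; case: nx; exists y.
exists e => A oA A0; have [x [Ax /fS[n fx]]] := dS A A0 oA.
by exists n; rewrite -(He n x fx).
Qed.

(** * Coding the points of a separable metrizable [G]-space *)

Section coding.
Variables (R : realType) (G : topologicalType).
Variables (mul : G -> G -> G) (inv : G -> G) (one : G).
Hypothesis hG : is_topological_group mul inv one.
Variable norm : G -> R.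
Hypothesis norm_ge0 : forall g, 0 <= norm g.
Hypothesis norm1 : norm one = 0.
Hypothesis normM : forall g h, norm (mul g h) <= norm g + norm h.
Hypothesis normV : forall g, norm (inv g) = norm g.
Hypothesis nbhs_norm : forall V, nbhs one V ->
  exists e : R, 0 < e /\ [set g | norm g < e] `<=` V.

Let mulA x y z : mul x (mul y z) = mul (mul x y) z. Proof. by case: hG. Qed.
Let mulx1 x : mul x one = x. Proof. by case: hG => _ /(_ x)[]. Qed.
Let mulVx x : mul (inv x) x = one. Proof. by case: hG => _ _ /(_ x)[]. Qed.

(* A root and a word of operations: the index set is a free term algebra, so that the
   relations in [is_code] do not depend on the space being coded. *)
Definition index : countType := (nat * nat * seq (bool * nat))%type.
Definition inner (i : index) (j : nat) : index := (i.1, (true, j) :: i.2).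
Definition outer (i : index) (j : nat) : index := (i.1, (false, j) :: i.2).

Local Notation rdist := (rdist mul inv norm).
Local Notation X := (code mul inv norm inner outer).

Variables (Y : topologicalType) (act : G -> Y -> Y).
Hypothesis actY : continuous_action mul one act.
Variable d : Y -> Y -> R.
Hypothesis d_ge0 : forall y z, 0 <= d y z.
Hypothesis d_eq0 : forall y z, d y z = 0 <-> y = z.
Hypothesis d_sym : forall y z, d y z = d z y.
Hypothesis d_triangle : forall x y z, d x z <= d x y + d y z.
Hypothesis d_open : forall A : set Y, open A <->
  (forall y, A y -> exists e : R, 0 < e /\ [set z | d y z < e] `<=` A).

Let act1 y : act one y = y. Proof. by case: actY. Qed.
Let actM g h y : act (mul g h) y = act g (act h y). Proof. by case: actY. Qed.
Let cact : continuous (fun p : G * Y => act p.1 p.2). Proof. by case: actY. Qed.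

Let d_self y : d y y = 0. Proof. exact/d_eq0. Qed.

Let ball_open y e : open [set z | d y z < e].
Proof.
apply/d_open => z /= ze; exists (e - d y z); rewrite subr_gt0; split=> // t /=.
by rewrite ltrBrDl; exact: le_lt_trans.
Qed.

Let act_near g y (A : set Y) : open A -> A (act g y) -> \forall z \near y, A (act g z).
Proof.
move=> oA Ay; have [|B [C [gB yC BC]]] := continuous_nbhs2 (x := g) (y := y) (A := A) cact.
  exact: open_near oA Ay.
by apply: filterS yC => z /(BC g); apply; exact: nbhs_singleton gB.
Qed.

Let act_near1 y (A : set Y) : open A -> A y ->
  exists e : R, 0 < e /\ \forall z \near y, forall g, norm g < e -> A (act g z).
Proof.
move=> oA Ay; have [|B [C [/nbhs_norm[e [e0 eB]] yC BC]]] :=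
  continuous_nbhs2 (x := one) (y := y) (A := A) cact.
  by rewrite /= act1; exact: open_near oA Ay.
by exists e; split=> //; apply: filterS yC => z Cz g /eB /BC; exact.
Qed.

Let eps (j : nat) : R := j.+1%:R^-1.

Let eps_gt0 j : 0 < eps j. Proof. by rewrite invr_gt0 ltr0n. Qed.

Let eps_lt r : 0 < r -> exists j, eps j < r.
Proof.
by move=> r0; have [j _ /(_ _ (leqnn j)) /= jr] := near_infty_natSinv_lt (PosNum r0); exists j.
Qed.

(** This interprets [outer]: it contains the complement of [U], hence covers the space together with
    [U]. *)
Let collar (U : set Y) j : set Y := [set y | exists z, ~ U z /\ d z y < eps j].

(** This interprets [inner]; the factor 2 leaves room for two displacements, each below [eps j]. *)
Let core (U : set Y) j : set Y :=
  [set y | forall g, norm g < 2 * eps j -> ~ collar U j (act g y)]°.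

Let collar_open U j : open (collar U j).
Proof.
rewrite (_ : collar U j = \bigcup_(z in ~` U) [set y | d z y < eps j]).
  by apply: bigcup_open => z _; exact: ball_open.
by apply/seteqP; split=> y [z]; [case=> nz zy; exists z|exists z].
Qed.

Let core_exhausts U y : open U -> U y -> exists j, core U j y.
Proof.
move=> oU Uy; have [r [r0 rU]] := (d_open U).1 oU y Uy.
have r2 : 0 < r / 2 by rewrite divr_gt0.
have [|e [e0 He]] := act_near1 (ball_open y (r / 2)) (y := y); first by rewrite /= d_self.
(* One [r / 2] bounds the motion, the other the width of the collar; [e / 2] ensures
   [2 * eps j < e]. *)
have [|j] := eps_lt (r := Num.min (r / 2) (e / 2)).
  by rewrite lt_min r2 divr_gt0.
rewrite lt_min => /andP[jr je]; exists j.
apply: filterS He => z Hz g ge [z' [nz' z'z]].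
apply: nz'; apply: rU => /=.
have yg : d y (act g z) < r / 2.
  by apply: Hz; apply: lt_trans ge _; rewrite mulrC -ltr_pdivlMr.
have := d_triangle y (act g z) z'; rewrite (d_sym (act g z) z').
by move: jr z'z; move: (eps j) => *; lra.
Qed.

Variable f : nat -> set Y.
Hypothesis f_uniq : forall n y z, f n y -> f n z -> y = z.
Hypothesis f_dense : forall A, open A -> A !=set0 -> exists n y, f n y /\ A y.

Let root (n : nat * nat) : set Y := [set y | exists z, f n.1 z /\ d z y < eps n.2].

(** The head of the word is applied last, so [U (inner i j)] and [U (outer i j)] compute to the core
    and the collar of [U i]. *)
Let U (i : index) : set Y :=
  foldr (fun p V => if p.1 then core V p.2 else collar V p.2) (root i.1) i.2.

Let U_open i : open (U i).
Proof.
case: i => n [|[[] j] s]; rewrite /U /=.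
- rewrite (_ : root n = \bigcup_(z in f n.1) [set y | d z y < eps n.2]).
    by apply: bigcup_open => z _; exact: ball_open.
  by apply/seteqP; split=> y [z]; [case=> nz zy; exists z|exists z].
- exact: open_interior.
- exact: collar_open.
Qed.

Let vals (y : Y) (i : index) (h : G) : set R :=
  [set c | c = 1 \/ exists g, U i (act g y) /\ c = rdist g h].
Let F (y : Y) (i : index) (h : G) : R := inf (vals y i h).

Let rd_ge0 g h : 0 <= rdist g h. Proof. exact: rdist_ge0. Qed.

Let rd_self g : rdist g g = 0. Proof. exact: (rdistxx hG). Qed.

Let rd_sym g h : rdist g h = rdist h g. Proof. exact: (rdistC hG). Qed.

Let rd_triangle g h k : rdist g k <= rdist g h + rdist h k.
Proof. exact: (rdist_triangle hG). Qed.

Let has_inf_vals y i h : has_inf (vals y i h).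
Proof.
split; first by exists 1; left.
by exists 0 => c [->|[g [_ ->]]].
Qed.

Let F_ge0 y i h : 0 <= F y i h.
Proof.
by apply: lb_le_inf => [|c [->|[g [_ ->]]]]//; have [] := has_inf_vals y i h.
Qed.

Let F_le1 y i h : F y i h <= 1.
Proof. by apply: ge_inf; [have [] := has_inf_vals y i h|left]. Qed.

Let F_le y i g h : U i (act g y) -> F y i h <= rdist g h.
Proof. by move=> Ug; apply: ge_inf; [have [] := has_inf_vals y i h|right; exists g]. Qed.

Let F_lt y i h r : r <= 1 -> F y i h < r -> exists g, U i (act g y) /\ rdist g h < r.
Proof.
move=> r1 /(inf_lt (has_inf_vals y i h).1)[c [->|[g [Ug ->]]] cr].
  by move: cr; rewrite ltNge r1.
by exists g.
Qed.

Let F_eq0 y i h : U i (act h y) -> F y i h = 0.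
Proof. by move=> /(F_le h); rewrite rd_self => h0; apply/eqP; rewrite eq_le h0 F_ge0. Qed.

Let F_code y : is_code mul inv norm inner outer (F y).
Proof.
split=> [i h|i h h'|i j h|i j h ah|i h r r0 r1 /(F_lt r1)[g [Ug gh]]].
- by rewrite F_ge0 F_le1.
- rewrite -lerBlDr; apply: lb_le_inf; first by have [] := has_inf_vals y i h'.
  move=> c [->|[g [Ug ->]]]; first by have := F_le1 y i h; have := rd_ge0 h h'; lra.
  by have := F_le h Ug; have := rd_triangle g h' h; rewrite (rd_sym h' h); lra.
- have [Uh|nU] := pselect (U i (act h y)); first by left; exact: F_eq0.
  by right; apply: F_eq0; exists (act h y); split=> //; rewrite d_self.
- have j1 : eps j <= 1 by rewrite invf_le1 ?ltr0n// ler1n.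
  rewrite leNgt; apply/negP => bh.
  have [g [Ug gh]] := F_lt j1 ah; have [g' [Ug' g'h]] := F_lt j1 bh.
  (* The element [mul g' (inv g)] moves a point of the core into the collar, yet its norm is
     [rdist g' g], below [2 * eps j]. *)
  apply: (interior_subset Ug (mul g' (inv g))); last first.
    by rewrite -actM -mulA mulVx mulx1.
  have := rd_triangle g' h g; rewrite (rd_sym h g) /rdist.
  by move: gh g'h; rewrite /rdist -/(eps j); move: (eps j) => *; lra.
have [j cj] := core_exhausts (U_open i) Ug.
exists j, g; rewrite rd_sym; split=> //.
by rewrite F_eq0.
Qed.

Let pi (y : Y) : X := exist _ (F y) (F_code y).

(** A bound below 1 is witnessed by a single [g] with [act g y] in an open set, and the same [g]
    serves all points near [y]. *)
Let pi_continuous : continuous pi.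
Proof.
move=> y; apply: code_cvg => i h r /= yr.
have [r1|r1] := ltP 1 r; first by apply: filterE => z; exact: le_lt_trans (F_le1 _ _ _) r1.
have [g [Ug gh]] := F_lt r1 yr.
by apply: filterS (act_near (U_open i) Ug) => z /(F_le h) /le_lt_trans; exact.
Qed.

Let pi_injective : injective pi.
Proof.
move=> y z /(congr1 sval) /= yz; apply: contrapT => neq.
have d0 : 0 < d y z by rewrite lt_neqAle d_ge0 andbT eq_sym; apply/eqP => /d_eq0.
(* A quarter suffices, as [y] and [z] will be joined by three steps shorter than [eps k], through
   [s] and [act g z]. *)
have [|k kd] := eps_lt (r := d y z / 4); first by rewrite divr_gt0.
have [|n [s [ns /= ys]]] := f_dense (ball_open y (eps k)).
  by exists y; rewrite /= d_self.
pose i : index := ((n, k), [::]).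
have Uy : U i (act one y) by rewrite act1; exists s; split=> //; rewrite d_sym.
have [e [e0 He]] := act_near1 (ball_open z (eps k)) (y := z) ltac:(by rewrite /= d_self).
(* Equality of codes makes [F z i one] vanish, so some [g] near [one] moves [z] into the ball that
   contains [y]. *)
have [||g [[t [/= nt tz]]]] := F_lt (r := Num.min e 1) (y := z) (i := i) (h := one).
- by rewrite ge_min lexx orbT.
- by rewrite -yz F_eq0// lt_min e0 ltr01.
rewrite lt_min => /andP[ge _].
have zg : d z (act g z) < eps k.
  apply: (nbhs_singleton He); move: ge.
  by rewrite /rdist (group_inv1 hG) mulx1.
move: tz; rewrite (f_uniq nt ns) => sz.
have := d_triangle y s z; have := d_triangle s (act g z) z.
clear yz neq; rewrite (d_sym (act g z)); move: ys kd sz zg; move: (eps k) => *; lra.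
Qed.

(** Replacing [k] by [mul k g] matches the two sets of distances, by right invariance. *)
Let pi_equivariant g y : pi (act g y) = code_act hG g (pi y).
Proof.
apply: code_eq => i h /=; congr inf; apply/seteqP; split=> c [->|[k [Uk ->]]]; try by left.
  right; exists (mul k g); rewrite actM; split=> //.
  by rewrite (rdistMr hG).
right; exists (mul k (inv g)); rewrite -actM -mulA mulVx mulx1; split=> //.
by rewrite -(rdistMr hG norm (mul k (inv g)) h g) -mulA mulVx mulx1.
Qed.

Lemma coding_map : exists pi : Y -> X, [/\ continuous pi, injective pi &
  forall g y, pi (act g y) = code_act hG g (pi y)].
Proof. by exists pi. Qed.

End coding.

(** * The universal Polish [G]-space *)

Theorem theorem0p4 (G : topologicalType) (mul : G -> G -> G) (inv : G -> G) (one : G)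
  (hG : is_topological_group mul inv one)
  (hsep : separable_space G) (hmet : metrizable G) :
  exists (X : topologicalType) (actX : G -> X -> X),
    [/\ polish X,
        continuous_action mul one actX &
        forall (Y : topologicalType) (actY : G -> Y -> Y),
          separable_space Y -> metrizable Y -> continuous_action mul one actY ->
          exists pi : Y -> X,
            [/\ continuous pi, injective pi &
                forall g y, pi (actY g y) = actX g (pi y)]].
Proof.
have [nu [nu_ge0 nu1 nuM nuV [nu_nbhs nbhs_nu]]] :=
  group_norm_exists Rdefinitions.R hG hmet.
(* The index algebra is fixed before any [Y], so one space receives all actions. *)
exists (code mul inv nu inner outer), (code_act hG (a := inner) (b := outer)); split.
- have [e He] := dense_sequence one hsep.
  apply: (code_polish hG nu_ge0 nu1 nuM nuV inner outer (e := e)) => h r r0.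
  (* The sequence is dense with respect to open sets, hence the passage to the interior of the
     ball. *)
  have [|n /interior_subset en] := 
    He (interior [set g | rdist mul inv nu g h < r]) (@open_interior _ _).
    by exists h; exact: (near_rdist hG nu_nbhs).
  by exists n.
- exact: (code_act_continuous hG nu_nbhs inner outer).
move=> Y actY [S [/countable_index[f [f_uniq fS]] dS]] [d [[d_ge0 d_eq0 d_sym d_tri] d_open]] hY.
apply: (coding_map hG nu_ge0 nu1 nuM nuV nbhs_nu hY d_ge0 d_eq0 d_sym d_tri d_open f_uniq).
move=> A oA A0; have [y [Ay /fS[n fy]]] := dS A A0 oA.
by exists n, y.
Qed.
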